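(* Let $n$ be a positive integer and let $G$ be the free abelian group generated by the triples $(B,E,I)$ with $B\subseteq[n]$, $E\subseteq[n]\setminus B$ and $I\subseteq B$. The function $F:\mathsf{Mat}_n\to G$ defined by $$F(M)=\sum_{B \text{ basis of } M} (B,E(B),I(B)),$$ where $E(B)$ and $I(B)$ are the sets of externally and internally active elements with respect to the basis $B$ of $M$, is a valuation under matroid subdivision.
   Context: Write $[n]=\{1,\dots,n\}$. A matroid is a pair $M=(E,\mathcal{B})$ where $E$ is a finite set and $\mathcal{B}$ is a collection of subsets of $E$ (the bases) satisfying the basis exchange axiom: if $B_1,B_2\in\mathcal{B}$ and $b_1\in B_1-B_2$, there is $b_2\in B_2-B_1$ with $(B_1-b_1)\cup b_2\in\mathcal{B}$. Contrary to custom, $(E,\emptyset)$ (no bases) is allowed as a matroid. $\mathsf{Mat}_n$ denotes the set of matroids with ground set $[n]$; the matroid $([n],\emptyset)$ is denoted $\emptyset$, and by convention every function $f$ on $\mathsf{Mat}_n$ that is considered satisfies $f(\emptyset)=0$. Let $B$ be a basis of $M=([n],\mathcal{B})$. An element $i\in B$ is internally active with respect to $B$ if $i<j$ for all $j\notin B$ such that $(B-i)\cup j\in\mathcal{B}$. An element $i\notin B$ is externally active with respect to $B$ if $i<j$ for all $j\in B$ such that $(B-j)\cup i\in\mathcal{B}$. $I(B)$ and $E(B)$ are the sets of internally and externally active elements with respect to $B$ (they depend on $M$). The matroid polytope of $M=([n],\mathcal{B})$ is $Q(M)=\mathrm{conv}\{e_B : B\in\mathcal{B}\}\subset\mathbb{R}^n$,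 where $e_B=\sum_{b\in B}e_b$ and $e_1,\dots,e_n$ is the standard basis. $M$ is determined by $Q(M)$, and any nonempty face of a matroid polytope is a matroid polytope. A subdivision of a polytope $P$ is a set of polytopes $\{P_1,\dots,P_m\}$ whose vertices are vertices of $P$, such that $P_1\cup\cdots\cup P_m=P$ and, for all $i<j$, if $P_i\cap P_j$ is nonempty then it is a proper face of both $P_i$ and $P_j$. A matroid subdivision of $M$ into $M_1,\dots,M_m$ is a subdivision of $Q(M)$ into the matroid polytopes $Q(M_1),\dots,Q(M_m)$. For $A\subseteq[m]$, $M_A$ is the matroid whose polytope is $\bigcap_{a\in A}Q(M_a)$ (so $M_A=\emptyset$ if this intersection is empty), with $M_\emptyset=M$ for the empty index set. For an abelian group $G$, a function $f:\mathsf{Mat}_n\to G$ is a valuation under matroid subdivision if for every matroid subdivision $\{M_1,\dots,M_m\}$ of every $M\in\mathsf{Mat}_n$, $\sum_{A\subseteq[m]}(-1)^{|A|}f(M_A)=0$; equivalently $f(M)=\sum_i f(M_i)-\sum_{i<j}f(M_{ij})+\sum_{i<j<k}f(M_{ijk})-\cdots$. *)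

(* Defs.v *)
From HB Require Import structures.
From mathcomp Require Import all_boot all_order all_algebra.
From mathcomp Require Import boolp classical_sets functions cardinality reals.
From mathcomp Require Import freeg.

Set Implicit Arguments.
Unset Strict Implicit.
Unset Printing Implicit Defensive.

Import Order.TTheory GRing.Theory Num.Theory.

(* The ground set [n] is 'I_n; only the order of its elements matters. *)

Section Matroids.
Variable n : nat.
Local Open Scope nat_scope.

Definition basis_exchange (Bs : {set {set 'I_n}}) : bool :=
  [forall B1 in Bs, forall B2 in Bs, forall b1 in B1 :\: B2,
    exists b2 in B2 :\: B1, b2 |: (B1 :\ b1) \in Bs].

(* Having no bases at all is allowed. *)
Record matroid := Matroid {
  bases : {set {set 'I_n}};
  _ : basis_exchange bases
}.

HB.instance Definition _ := [isSub for bases].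
HB.instance Definition _ := [Finite of matroid by <:].

Lemma basis_exchange0 : basis_exchange finset.set0.
Proof. by apply/forall_inP => B; rewrite inE. Qed.

Definition empty_matroid : matroid := Matroid basis_exchange0.

Definition int_active (M : matroid) (B : {set 'I_n}) : {set 'I_n} :=
  [set i in B | [forall j, (j \notin B) ==> (j |: (B :\ i) \in bases M)
                             ==> (i < j)]].

Definition ext_active (M : matroid) (B : {set 'I_n}) : {set 'I_n} :=
  [set i in ~: B | [forall j, (j \in B) ==> (i |: (B :\ j) \in bases M)
                                ==> (i < j)]].

(* The triples (B, E, I), encoded as ((B, E), I). *)
Definition is_triple (t : {set 'I_n} * {set 'I_n} * {set 'I_n}) : bool :=
  (t.1.2 \subset ~: t.1.1) && (t.2 \subset t.1.1).

Definition triple := {t | is_triple t}.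

Lemma activity_is_triple (M : matroid) (B : {set 'I_n}) :
  is_triple (B, ext_active M B, int_active M B).
Proof.
by apply/andP; split; apply/fintype.subsetP => i /=; rewrite inE => /andP[].
Qed.

Definition activity_triple (M : matroid) (B : {set 'I_n}) : triple :=
  exist _ (B, ext_active M B, int_active M B) (activity_is_triple M B).

End Matroids.

Local Open Scope classical_set_scope.
Local Open Scope ring_scope.

Definition activity_sum (n : nat) (M : matroid n) : {freeg (triple n)} :=
  \sum_(B in bases M) << activity_triple M B >>.

Section Polytopes.
Variables (R : realType) (n : nat).
Implicit Types (P F : set 'rV[R]_n).

Definition conv_hull (V : set 'rV[R]_n) : set 'rV[R]_n :=
  [set x | exists k (v : 'I_k -> 'rV[R]_n) (a : 'I_k -> R),
     [/\ forall i, V (v i), forall i, 0 <= a i, \sum_i a i = 1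
       & x = \sum_i a i *: v i]].

Definition is_polytope P : Prop :=
  exists2 V : set 'rV[R]_n, finite_set V & P = conv_hull V.

(* Both P and the empty set are faces of P (take c = 0). *)
Definition is_face F P : Prop :=
  exists (c : 'cV[R]_n) (b : R),
    (forall x, P x -> (x *m c) 0 0 <= b) /\
    F = [set x | P x /\ (x *m c) 0 0 = b].

Definition is_proper_face F P : Prop := is_face F P /\ F <> P.

Definition vertices P : set 'rV[R]_n := [set v | is_face [set v] P].

Record is_subdivision (m : nat) P (Ps : 'I_m -> set 'rV[R]_n) : Prop := {
  subdiv_polytope : is_polytope P;
  subdiv_polytopes : forall i, is_polytope (Ps i);
  subdiv_distinct : injective Ps;
  subdiv_vertices : forall i, vertices (Ps i) `<=` vertices P;
  subdiv_cover : \bigcup_i Ps i = P;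
  subdiv_faces : forall i j : 'I_m, (i < j)%N -> Ps i `&` Ps j !=set0 ->
    is_proper_face (Ps i `&` Ps j) (Ps i) /\
    is_proper_face (Ps i `&` Ps j) (Ps j)
}.

Definition indicator (B : {set 'I_n}) : 'rV[R]_n :=
  \sum_(b in B) delta_mx 0 b.

Definition matroid_polytope (M : matroid n) : set 'rV[R]_n :=
  conv_hull [set indicator B | B in [set` bases M]].

Definition is_matroid_subdivision (m : nat) (M : matroid n)
    (Ms : 'I_m -> matroid n) : Prop :=
  is_subdivision (matroid_polytope M) (fun i => matroid_polytope (Ms i)).

(* The matroid M_A. In a matroid subdivision the intersection below is empty
   or a face of some Q(M_a), hence it is the polytope of a matroid, which is
   unique; the default value of xget is then never used. *)
Definition subdivision_meet (m : nat) (M : matroid n) (Ms : 'I_m -> matroid n)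
    (A : {set 'I_m}) : matroid n :=
  if A == finset.set0 then M
  else xget (empty_matroid n)
    [set N | matroid_polytope N =
             \bigcap_(a in [set` A]) matroid_polytope (Ms a)].

(* The first conjunct is the standing convention on functions on matroids. *)
Definition is_valuation (G : zmodType) (f : matroid n -> G) : Prop :=
  f (empty_matroid n) = 0 /\
  forall (m : nat) (M : matroid n) (Ms : 'I_m -> matroid n),
    is_matroid_subdivision M Ms ->
    \sum_(A : {set 'I_m}) f (subdivision_meet M Ms A) *~ (-1) ^+ #|A| = 0.

End Polytopes.

(* Main.v *)
Require Import Defs.
From mathcomp Require Import boolp classical_sets.
From mathcomp Require Import all_boot all_order all_algebra reals freeg.
From mathcomp Require Import topology normedtype derive ring zify.

(** Fix a set [B] and a set [X] of elements asked to be active. Give the element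
    [i] the weight [2 ^ i], with sign [-] when [i] is in both or in neither of
    [B] and [X], and [+] otherwise. With these signs, an exchange of [x] in [B]
    for [y] outside [B] increases the weight exactly when it is forbidden by the
    requested activities; as a basis that no single exchange improves is a
    maximum-weight basis, [B] is a basis of [M] in which all of [X] is active
    iff [B] is the maximum-weight basis of [M] ([max_basis_active]). Distinct
    sets have distinct weights ([weight_activity_inj]), so this says that the
    linear functional with these coefficients has maximum [weight B] on the
    polytope of [M] ([max_value_matroid_polytope]).

    The condition that a fixed linear functional has a fixed maximum value is a
    valuation on compact convex sets ([sum_max_value_pointwise]): if an integer
    combination of indicator functions of compact convex sets vanishes at every
    point, the same combination of the indicators of the sets with the given
    maximum vanishes. This is the classical argument that the Euler
    characteristic is a valuation, by slicing with parallel hyperplanes and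
    induction on the dimension: the parameters of the hyperplanes that meet a
    compact convex set form a closed interval, whose upper end is detected by
    comparing its indicator at a value and just above it.

    In a subdivision, the polytope of [subdivision_meet A] is the intersection of
    the pieces indexed by [A] ([subdivision_meet_polytope]), since a face of a
    matroid polytope is again one, by the symmetric exchange property. Hence the
    alternating sum of the indicators of these polytopes is zero at each point
    ([sum_subdivision_meet]), and therefore the signed number of the [A] for
    which [B] is a basis with all of [X] active is zero. Passing from the
    activity set containing [X] to its being equal to [X] is a downward
    induction ([sum_supersets_eq0]), and the resulting numbers, all zero, are the
    coefficients of the triples in the alternating sum of the
    [activity_sum]s. *)

Set Implicit Arguments.
Unset Strict Implicit.
Unset Printing Implicit Defensive.

Import Order.TTheory GRing.Theory Num.Theory.
Import numFieldNormedType.Exports.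

(** * Basis exchange *)

Section Exchange.
Variables (n : nat) (M : matroid n).
Implicit Types (B I : {set 'I_n}) (x y : 'I_n).

Lemma exchange B1 B2 x : B1 \in bases M -> B2 \in bases M -> x \in B1 :\: B2 ->
  exists2 y, y \in B2 :\: B1 & y |: (B1 :\ x) \in bases M.
Proof.
move=> B1M B2M xB; case: M B1M B2M => Bs exBs /= B1M B2M.
by move/forall_inP: exBs => /(_ _ B1M)/forall_inP/(_ _ B2M)/forall_inP/(_ _ xB)
  /exists_inP.
Qed.

Lemma bases_card B1 B2 : B1 \in bases M -> B2 \in bases M -> #|B1| = #|B2|.
Proof.
have [k] := ubnP #|B1 :\: B2|; elim: k B1 => // k IHk B1 ltk B1M B2M.
have [B12|[x xB]] := set_0Vmem (B1 :\: B2).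
  have [B21|[y yB]] := set_0Vmem (B2 :\: B1).
    congr #|pred_of_set _|; apply/eqP.
    by rewrite eqEsubset -!setD_eq0 B12 B21 eqxx.
  by have [z] := exchange B2M B1M yB; rewrite B12 inE.
have [y yB B'M] := exchange B1M B2M xB.
move: xB yB; rewrite !inE => /andP[xB2 xB1] /andP[yB1 yB2].
rewrite -(IHk _ _ B'M B2M).
  rewrite cardsU1 !inE (negPf yB1) andbF /= [in LHS](cardsD1 x B1) xB1.
  by [].
have -> : (y |: B1 :\ x) :\: B2 = (B1 :\: B2) :\ x.
  apply/setP => z; rewrite !inE; case: (eqVneq z y) => [->|] /=.
    by rewrite yB2 andbF.
  by case: (z == x); case: (z \in B2).
by move: ltk; rewrite (cardsD1 x (B1 :\: B2)) !inE xB2 xB1.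
Qed.

(** Among the bases containing [I], one with the fewest elements outside
    [I :|: B2] has none: any such element could be exchanged for one of
    [B2]. *)
Lemma augmentation I B1 B2 : B1 \in bases M -> B2 \in bases M ->
  I \subset B1 ->
  exists2 B, B \in bases M & (I \subset B) && (B \subset I :|: B2).
Proof.
have [k] := ubnP #|B1 :\: (I :|: B2)|; elim: k B1 => // k IHk B1 ltk B1M B2M IB1.
have [B1s|[x xB]] := set_0Vmem (B1 :\: (I :|: B2)).
  by exists B1; rewrite // IB1 -setD_eq0 B1s eqxx.
have xI : x \notin I by move: xB; rewrite !inE negb_or => /andP[/andP[]].
have xB12 : x \in B1 :\: B2 by move: xB; rewrite !inE negb_or => /andP[/andP[_ ->]].
have [y yB B'M] := exchange B1M B2M xB12.
apply: (IHk _ _ B'M B2M).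
  rewrite -ltnS; apply: leq_trans _ ltk; rewrite (cardsD1 x (B1 :\: _)) xB add1n !ltnS.
  apply/subset_leq_card/subsetP => z; rewrite !inE.
  case: (eqVneq z y) => [->|] /=; last by case: (z == x); rewrite ?andbF.
  by move: yB; rewrite !inE => /andP[_ ->]; rewrite orbT.
apply/subsetP => z zI; rewrite !inE (subsetP IB1 _ zI).
by rewrite (contraTneq _ zI) ?orbT // => ->.
Qed.

(** Let [Y] be the fundamental circuit of [x] in [B2], without [x]. As no basis
    contains [x |: Y], extending [Y] by elements of [B1] gives a basis [B5]
    avoiding [x]. Exchanging [x] out of [B1] against [B5] brings in an element
    of [B5] outside [B1], which can only come from [Y]. *)
Lemma symmetric_exchange B1 B2 x : B1 \in bases M -> B2 \in bases M ->
  x \in B1 :\: B2 ->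
  exists2 y, y \in B2 :\: B1 &
    (y |: (B1 :\ x) \in bases M) && (x |: (B2 :\ y) \in bases M).
Proof.
move=> B1M B2M xB; have /andP[xB2 xB1] : (x \notin B2) && (x \in B1).
  by rewrite -in_setD.
pose Y := [set y in B2 | x |: (B2 :\ y) \in bases M].
have YB2 : Y \subset B2 by apply/subsetP => y; rewrite inE => /andP[].
have xYdep B : B \in bases M -> ~~ (x |: Y \subset B).
  move=> BM; apply/negP => xYB.
  have [B4 B4M /andP[xY4 B4s]] := augmentation BM B2M xYB.
  have x4 : x \in B4 by rewrite (subsetP xY4) ?setU11.
  have [/eqP|[z]] := set_0Vmem (B2 :\: B4).
    rewrite setD_eq0 => B24.
    have /eqP E : B2 == B4 by rewrite eqEcard B24 (bases_card B4M B2M) leqnn.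
    by move: xB2; rewrite E x4.
  rewrite inE => /andP[z4 z2].
  suff B4E : B4 = x |: (B2 :\ z).
    by case/negP: z4; rewrite (subsetP xY4) // !inE z2 -B4E B4M orbT.
  apply/eqP; rewrite eqEcard cardsU1 !inE (negPf xB2) andbF /=.
  rewrite (bases_card B4M B2M) (cardsD1 z B2) z2 leqnn andbT.
  apply/subsetP => w w4; have := subsetP B4s _ w4; rewrite !inE -orbA.
  have wz : w != z by apply: contraNneq z4 => <-.
  rewrite wz; case/or3P => [->//|/andP[-> _]|->]; by rewrite orbT.
have [B5 B5M /andP[Y5 B5s]] := augmentation B2M B1M YB2.
have x5 : x \notin B5.
  by apply/negP => x5; case/negP: (xYdep _ B5M); rewrite finset.subUset Y5 sub1set x5.
have xB15 : x \in B1 :\: B5 by rewrite inE x5.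
have [y] := exchange B1M B5M xB15.
rewrite inE => /andP[yB1 y5] BM.
have := subsetP B5s _ y5; rewrite !inE (negPf yB1) orbF => /andP[y2 B2M'].
by exists y; rewrite ?inE ?yB1 ?BM.
Qed.

End Exchange.

(** * Maximum-weight bases *)

Local Open Scope ring_scope.

Definition weight (n : nat) (V : zmodType) (c : 'I_n -> V) (B : {set 'I_n}) : V :=
  \sum_(i in B) c i.

Lemma weight_swap n (V : zmodType) (c : 'I_n -> V) (B : {set 'I_n}) x y :
  x \in B -> y \notin B -> weight c (y |: (B :\ x)) = weight c B - c x + c y.
Proof.
move=> xB yB; rewrite /weight big_setU1 ?inE ?(negPf yB) ?andbF //=.
by rewrite (big_setD1 x xB) /= [c x + _]addrC addrK addrC.
Qed.

Section Weights.
Variables (n : nat) (M : matroid n) (V : realDomainType) (c : 'I_n -> V).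
Implicit Types (B : {set 'I_n}).

Definition max_basis B :=
  (B \in bases M) && [forall B' in bases M, weight c B' <= weight c B].

(** The weights lost and gained in the two halves of a symmetric exchange cancel,
    so that neither half can leave the set of bases of weight [b]. *)
Lemma tight_bases_exchange (b : V) :
  (forall B, B \in bases M -> weight c B <= b) ->
  basis_exchange [set B in bases M | weight c B == b].
Proof.
move=> cb; apply/forall_inP => B1; rewrite inE => /andP[B1M /eqP c1].
apply/forall_inP => B2; rewrite inE => /andP[B2M /eqP c2].
apply/forall_inP => x xB; have [y yB /andP[M1 M2]] := symmetric_exchange B1M B2M xB.
apply/exists_inP; exists y; rewrite // inE M1 /=.
move: xB yB; rewrite !inE => /andP[x2 x1] /andP[y1 y2].
rewrite eq_le cb //=; have := cb _ M2.
rewrite !weight_swap // c1 c2 -!addrA gerDl lerDl.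
by rewrite addrC subr_le0 [- c x + _]addrC subr_ge0.
Qed.

Hypothesis c_inj : forall i j, i != j -> c i != c j.

(** Let [B'] be a maximum-weight basis. If it differs from [B], a symmetric
    exchange replaces [x] by [y] in [B] and [y] by [x] in [B']; neither gains
    weight, so [x] and [y] have the same weight, although they differ. *)
Lemma local_max_basis B : B \in bases M ->
  (forall x y, x \in B -> y \notin B -> y |: (B :\ x) \in bases M -> c y <= c x) ->
  max_basis B.
Proof.
move=> BM locB; rewrite /max_basis BM /=.
have [B' B'M B'max] : exists2 B', B' \in bases M &
    forall B'', B'' \in bases M -> weight c B'' <= weight c B'.
  case: (Order.TotalTheory.arg_maxP (weight c) BM) => B' B'M B'max.
  by exists B'.
suff -> : B = B' by apply/forall_inP.
have [/eqP BB'|[x xB]] := set_0Vmem (B :\: B').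
  by apply/eqP; rewrite eqEcard -setD_eq0 BB' (bases_card B'M BM) leqnn.
have [y yB /andP[M1 M2]] := symmetric_exchange BM B'M xB.
move: xB yB; rewrite !inE => /andP[x2 x1] /andP[y1 y2].
have xy : x != y by apply: contraNneq y1 => <-.
have := B'max _ M2; rewrite weight_swap // -addrA gerDl addrC subr_le0 => cxy.
by have := c_inj xy; rewrite eq_le cxy (locB _ _ x1 y1 M1).
Qed.

End Weights.

(** * Activities as weights *)

Section Activity.
Variable n : nat.
Implicit Types (M : matroid n) (B X : {set 'I_n}).

(** The sets [E] and [I] of a triple are recovered from their union as the parts
    outside and inside [B], so one set suffices to record both. *)
Definition active M B := ext_active M B :|: int_active M B.

Lemma activity_triple_eq M N B :
  active M B = active N B -> activity_triple M B = activity_triple N B.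
Proof.
have extE K : ext_active K B = active K B :\: B.
  by apply/setP => i; rewrite !inE; case: (i \in B); rewrite ?andbF ?orbF.
have intE K : int_active K B = active K B :&: B.
  by apply/setP => i; rewrite !inE; case: (i \in B); rewrite ?andbT ?andbF.
by move=> eqMN; apply: val_inj; rewrite /= !extE !intE eqMN.
Qed.

Definition activity_weight B X (i : 'I_n) : int :=
  (-1) ^+ ((i \in B) == (i \in X)) * 2 ^+ i.

Lemma pow2_gt0 i : 0 < 2 ^+ i :> int.
Proof. exact: exprn_gt0. Qed.

Lemma ler_pow2 i j : (2 ^+ i <= 2 ^+ j :> int) = (i <= j)%N.
Proof. exact: ler_eXn2l. Qed.

Lemma activity_weight_inj B X i j :
  i != j -> activity_weight B X i != activity_weight B X j.
Proof.
apply: contraNneq => /(congr1 Num.norm).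
by rewrite !normrM !normr_sign !mul1r !normrX => /(@ieexprIn _ 2)/ord_inj->.
Qed.

(** The signs are such that, for [x] in [B] and [y] outside, replacing [x] by
    [y] increases the weight exactly when it witnesses that [x], an element of
    [X], is not internally active or that [y], an element of [X], is not
    externally active. *)
Lemma max_basis_active M B X :
  max_basis M (activity_weight B X) B =
    (B \in bases M) && (X \subset active M B).
Proof.
rewrite [LHS]/max_basis; case: (boolP (B \in bases M)) => //= BM.
apply/idP/idP => [/forall_inP maxB | /subsetP XB].
  have swap x y : x \in B -> y \notin B -> y |: B :\ x \in bases M ->
      activity_weight B X y <= activity_weight B X x.
    by move=> xB yB /maxB; rewrite weight_swap // -addrA gerDl addrC subr_le0.
  apply/subsetP => z zX; rewrite !inE; case: (boolP (z \in B)) => zB /=.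
    apply/forallP => j; apply/implyP => jB; apply/implyP => /(swap _ _ zB jB).
    have zj : z != j by apply: contraNneq jB => <-.
    rewrite /activity_weight zB zX (negPf jB) ltn_neqAle zj.
    case: (j \in X); rewrite /= ?mulN1r ?mul1r ?lerN2 ?ler_pow2 //.
    by have := pow2_gt0 z; have := pow2_gt0 j; lia.
  rewrite orbF; apply/forallP => j; apply/implyP => jB; apply/implyP.
  move=> /(swap _ _ jB zB); have zj : z != j by apply: contraNneq zB => ->.
  rewrite /activity_weight jB zX (negPf zB) ltn_neqAle zj.
  case: (j \in X); rewrite /= ?mulN1r ?mul1r ?lerN2 ?ler_pow2 //.
  by have := pow2_gt0 z; have := pow2_gt0 j; lia.
have /andP[_ //] : max_basis M (activity_weight B X) B.
apply: local_max_basis => //; first exact: activity_weight_inj.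
move=> x y xB yB xyM; have := XB x; have := XB y.
rewrite !inE xB (negPf yB) /= orbF /activity_weight xB (negPf yB).
have := pow2_gt0 x; have := pow2_gt0 y.
case: (y \in X) => y0 x0.
  move=> /(_ isT)/forallP/(_ x)/implyP/(_ xB)/implyP/(_ xyM) ltyx.
  case: (x \in X) => [|_]; last by rewrite /= !mul1r ler_pow2 ltnW.
  move=> /(_ isT)/forallP/(_ y)/implyP/(_ yB)/implyP/(_ xyM) ltxy.
  by have := ltn_trans ltyx ltxy; rewrite ltnn.
move=> _; case: (x \in X) => [|_]; last by rewrite /= mul1r mulN1r; lia.
move=> /(_ isT)/forallP/(_ y)/implyP/(_ yB)/implyP/(_ xyM) ltxy.
by rewrite /= !mulN1r lerN2 ler_pow2 ltnW.
Qed.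

(** Uniqueness of signed binary expansions, by parity of the lowest digit. *)
Lemma signed_binary_eq0 m (d : 'I_m -> int) :
  (forall i, `|d i| <= 1) -> \sum_i d i * 2 ^+ i = 0 -> forall i, d i = 0.
Proof.
elim: m d => [|m IHm] d d1; first by move=> _ [].
rewrite big_ord_recl expr0 mulr1.
(* Halving the sum of the higher digits leaves an expansion of length [m]. *)
under eq_bigr do rewrite lift0 exprS mulrCA.
rewrite -mulr_sumr => sum0.
have d00 : d ord0 = 0 by have := d1 ord0; lia.
have dl0 := IHm (fun i => d (fintype.lift ord0 i)) (fun i => d1 _).
move=> i; case: (unliftP ord0 i) => [j|] -> //; apply: dl0.
by apply/eqP; move/eqP: sum0; rewrite d00 add0r mulf_eq0.
Qed.

Lemma weight_activity_inj B X : injective (weight (activity_weight B X)).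
Proof.
move=> B1 B2; rewrite /weight !(big_mkcond (fun i => i \in _)) => /eqP.
rewrite -subr_eq0 -sumrB => /eqP sum0.
pose d i : int := (-1) ^+ ((i \in B) == (i \in X)) *
  ((i \in B1)%:R - (i \in B2)%:R).
have d0 : forall i, d i = 0.
  apply: signed_binary_eq0 => [i|].
    by rewrite normrM normr_sign mul1r; case: (i \in B1); case: (i \in B2).
  rewrite -[RHS]sum0; apply: eq_bigr => i _; rewrite /d /activity_weight.
  by case: (i \in B1); case: (i \in B2) => /=; ring.
apply/setP => i; move/eqP: (d0 i); rewrite mulf_eq0 signr_eq0 /=.
by case: (i \in B1); case: (i \in B2).
Qed.

End Activity.

(** * From activity sets to triples *)

(** Moebius inversion over the Boolean lattice, by downward induction on [X]. *)
Lemma sum_supersets_eq0 (V : zmodType) (J T : finType) (P : pred J)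
    (h : J -> {set T}) (w : J -> V) :
  (forall X : {set T}, \sum_(j | P j && (X \subset h j)) w j = 0) ->
  forall X, \sum_(j | P j && (h j == X)) w j = 0.
Proof.
move=> supw X; have [k] := ubnP #|~: X|; elim: k X => // k IHk X ltk.
have := supw X; rewrite (bigID (fun j => h j == X)) /=.
rewrite (eq_bigl (fun j => P j && (h j == X))); last first.
  by move=> j; rewrite -andbA; case: eqP => [->|]; rewrite ?subxx ?andbF.
rewrite [X in _ + X](partition_big h (fun Y => X \proper Y)) /=; last first.
  by move=> j /andP[/andP[_ Xj] hj]; rewrite properEneq eq_sym hj.
rewrite [X in _ + X]big1 ?addr0 // => Y XY.
rewrite -[RHS](IHk Y) => [|].
  apply: eq_bigl => j; case: (eqVneq (h j) Y) => [->|]; rewrite ?andbF //.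
  by rewrite (proper_sub XY) eq_sym (proper_neq XY) !andbT.
rewrite -ltnS; apply: leq_trans _ ltk; rewrite ltnS proper_card //.
by rewrite properC.
Qed.

Lemma activity_sum_combination_eq0 n (J : finType) (N : J -> matroid n)
    (w : J -> int) :
  (forall B X : {set 'I_n},
     \sum_(j | (B \in bases (N j)) && (X \subset active (N j) B)) w j = 0) ->
  \sum_j activity_sum (N j) *~ w j = 0.
Proof.
move=> supw; rewrite /activity_sum.
under eq_bigr do rewrite mulrz_suml.
rewrite (exchange_big_dep predT) //= big1 // => B _.
rewrite (partition_big (fun j => active (N j) B) predT) //= big1 // => X _.
have w0 := sum_supersets_eq0 (supw B) X.
have [/existsP[j0 /andP[_ /eqP j0X]]|] :=
    boolP [exists j, (B \in bases (N j)) && (active (N j) B == X)].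
  (* All terms carry the same triple, that of [j0]. *)
  rewrite -[RHS](mulr0z (<< activity_triple (N j0) B >> : {freeg (triple n)})).
  rewrite -w0 mulrz_sumr; apply: eq_bigr => j /andP[_ /eqP jX].
  by rewrite (@activity_triple_eq _ (N j) (N j0)) ?jX.
rewrite negb_exists => /forallP noj; apply: big_pred0 => j.
exact/negbTE/noj.
Qed.

(** * Slices of compact convex sets *)

(** Expansion of the product over all [j] of [1 - 1_J(j)]. *)
Lemma alternating_sum_subsets (I : finType) (J : {set I}) :
  J != finset.set0 -> \sum_(A : {set I} | A \subset J) (-1) ^+ #|A| = 0 :> int.
Proof.
case/set0Pn => j0 j0J.
have prod0 : \prod_(j : I) (- (j \in J)%:R + 1) = 0 :> int.
  by rewrite (bigD1 j0) //= j0J addNr mul0r.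
rewrite -[RHS]prod0 bigA_distr.
rewrite big_mkcond; apply: eq_bigr => A _; rewrite -big_mkcond /=.
case: ifPn => [AJ|/subsetPn[j jA jJ]].
  rewrite (eq_bigr (fun=> -1)) ?prodr_const // => j jA.
  by rewrite (fintype.subsetP AJ).
by rewrite (bigD1 j) //= (negPf jJ) oppr0 mul0r.
Qed.

Local Open Scope classical_set_scope.

Section Sweep.
Variables (R : realType) (n : nat).
Implicit Types (K : set 'rV[R]_n) (c : 'cV[R]_n) (x y : 'rV[R]_n).

Definition dot c x : R := (x *m c) 0 0.

Lemma dotD c x y : dot c (x + y) = dot c x + dot c y.
Proof. by rewrite /dot mulmxDl mxE. Qed.

Lemma dotZ c a x : dot c (a *: x) = a * dot c x.
Proof. by rewrite /dot -scalemxAl mxE. Qed.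

Lemma dot_delta (j : 'I_n) x : dot (delta_mx j 0) x = x 0 j.
Proof.
rewrite /dot mxE (bigD1 j) //= big1 => [|i ij]; rewrite mxE ?eqxx ?mulr1 ?addr0 //.
by rewrite (negPf ij) mulr0.
Qed.

Lemma continuous_dot c : continuous (dot c).
Proof.
have -> : dot c = fun x => \sum_j x 0 j * c j 0.
  by apply/funext => x; rewrite /dot mxE.
apply: continuous_big => [|j _ x]; first exact: add_continuous.
apply: (@cvgM _ _ (nbhs x)); last exact: cvg_cst.
exact: coord_continuous.
Qed.

Definition hyperplane c (t : R) : set 'rV[R]_n := [set x | dot c x = t].

Lemma closed_hyperplane c t : closed (hyperplane c t).
Proof.
apply: (@preimage_closed _ _ (dot c) [set t]); last exact: closed_eq.
by move=> x _; exact: continuous_dot.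
Qed.

Definition compact_convex K := compact K /\
  forall x y t, K x -> K y -> 0 <= t -> t <= 1 -> K (t *: x + (1 - t) *: y).

Lemma compact_convex_slice K c t :
  compact_convex K -> compact_convex (K `&` hyperplane c t).
Proof.
move=> [Kc Kv]; split.
  by apply: compact_closedI => //; exact: closed_hyperplane.
move=> x y s [Kx xt] [Ky yt] s0 s1; split; first exact: Kv.
by rewrite /hyperplane /= dotD !dotZ xt yt; ring.
Qed.

Definition max_value K c (t : R) :=
  (exists2 x, K x & dot c x = t) /\ (forall x, K x -> dot c x <= t).

Lemma compact_max_value K c : compact K -> K !=set0 -> exists t, max_value K c t.
Proof.
move=> Kc K0; have [|x] := compact_EVT_max (f := dot c) K0 Kc.
  by apply: continuous_subspaceT => ?; exact: continuous_dot.
move=> /set_mem Kx xmax; exists (dot c x); split; first by exists x.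
by move=> y Ky; apply: xmax; exact: mem_set.
Qed.

Lemma max_value_uniq K c s t : max_value K c s -> max_value K c t -> s = t.
Proof.
move=> [[x Kx <-] xs] [[y Ky <-] ys].
by apply/eqP; rewrite eq_le ys ?xs.
Qed.

(** The slices of a compact convex set are nonempty exactly over a closed
    interval, which has its upper end at [t] iff it contains [t] but no value
    slightly above. *)
Lemma max_value_near K c t : compact_convex K ->
  \forall s \near t^'+,
    (`[< K `&` hyperplane c t !=set0 >] =
     `[< max_value K c t >] + `[< K `&` hyperplane c s !=set0 >] :> nat)%N.
Proof.
move=> [Kc Kv]; have [[x [Kx xt]]|Kt0] := pselect (K `&` hyperplane c t !=set0).
  have [[y Ky ty]|notabove] := pselect (exists2 y, K y & t < dot c y).
    near=> s; have ts : t < s by near: s; exact: nbhs_right_gt.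
    have sy : s < dot c y by near: s; exact: nbhs_right_lt.
    have Ks : K `&` hyperplane c s !=set0.
      (* The barycentre of [x] and [y] on which the functional is [s]. *)
      pose r := (dot c y - s) / (dot c y - t).
      have ty0 : 0 < dot c y - t by rewrite subr_gt0.
      exists (r *: x + (1 - r) *: y); split.
        apply: Kv => //; first by apply: divr_ge0; rewrite subr_ge0 ltW.
        by rewrite ler_pdivrMr // mul1r lerD2l lerN2 ltW.
      rewrite /hyperplane /= dotD !dotZ xt /r; field.
      by rewrite gt_eqF.
    have notmax : ~ max_value K c t by case=> _ /(_ _ Ky); rewrite leNgt ty.
    by rewrite (asboolT Ks) (asboolF notmax) asboolT //; exists x.
  have maxt : max_value K c t.
    split; first by exists x.
    move=> y Ky; rewrite leNgt; apply/negP => ty; apply: notabove.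
    by exists y.
  near=> s; have ts : t < s by near: s; exact: nbhs_right_gt.
  have Ks0 : ~ (K `&` hyperplane c s !=set0).
    by move=> [y [Ky ys]]; have := maxt.2 _ Ky; rewrite ys leNgt ts.
  by rewrite (asboolT maxt) (asboolF Ks0) asboolT //; exists x.
have Knt : ~ max_value K c t by move=> [[x Kx xt] _]; apply: Kt0; exists x.
have cl : closed (dot c @` K).
  apply: compact_closed; first exact: norm_hausdorff.
  apply: continuous_compact => //.
  by apply: continuous_subspaceT => ?; exact: continuous_dot.
have near_t : \forall s \near t^'+, (~` (dot c @` K)) s.
  apply: cvg_within; apply: open_nbhs_nbhs; split; first exact: closed_openC.
  by move=> [x Kx xt]; apply: Kt0; exists x.
apply: filterS near_t => s Ks'; have Ks : ~ (K `&` hyperplane c s !=set0).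
  move=> [x [Kx xs]].
  by apply: Ks'; exists x.
by rewrite !asboolF.
Unshelve. all: by end_near. Qed.

End Sweep.

(** * The Euler characteristic is a valuation *)

Section Euler.
Variables (R : realType) (n : nat) (I : finType).
Implicit Types (K : I -> set 'rV[R]_n) (w : I -> int) (c : 'cV[R]_n).

Lemma sum_max_value K w c : (forall i, compact_convex (K i)) ->
  (forall t, \sum_(i | `[< K i `&` hyperplane c t !=set0 >]) w i = 0) ->
  forall t, \sum_(i | `[< max_value (K i) c t >]) w i = 0.
Proof.
move=> ccK sum0 t.
have [s sP] := filter_ex
  (filter_forall _ (fun i => max_value_near c t (ccK i)) (F := t^'+)).
have := sum0 t; rewrite big_mkcond /=.
under eq_bigr do rewrite -mulrb sP mulrnDr !mulrb.
by rewrite big_split -!big_mkcond /= sum0 addr0.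
Qed.

(** Every nonempty set of the family has exactly one maximum value, so the sum
    splits according to it. *)
Lemma sum_nonempty_slices K w c : (forall i, compact_convex (K i)) ->
  (forall t, \sum_(i | `[< K i `&` hyperplane c t !=set0 >]) w i = 0) ->
  \sum_(i | `[< K i !=set0 >]) w i = 0.
Proof.
move=> ccK sum0; pose u i := xget 0 [set t | max_value (K i) c t].
have uP i : K i !=set0 -> max_value (K i) c (u i).
  by move=> K0; apply: xgetPex; exact: compact_max_value (ccK i).1 K0.
pose s := undup [seq u i | i <- enum I].
transitivity (\sum_(t <- s) \sum_(i | `[< K i !=set0 >] && (u i == t)) w i).
  rewrite (exchange_big_dep (fun i => `[< K i !=set0 >])) => [|t i _ /andP[]//].
  apply: eq_bigr => i Ki; rewrite -big_filter.
  rewrite (_ : [seq t <- s | _] = [:: u i]) ?big_seq1 //.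
  rewrite -(@filter_pred1_uniq _ s) ?undup_uniq //; last first.
    by rewrite mem_undup; apply: map_f; rewrite mem_enum.
  by apply: eq_filter => t /=; rewrite Ki eq_sym.
rewrite big1 // => t _; rewrite -[RHS](sum_max_value ccK sum0 t).
apply: eq_bigl => i; apply/andP/asboolP => [[/asboolP K0 /eqP <-]|maxt].
  exact: uP.
have K0 : K i !=set0 by have [[x Kx _] _] := maxt; exists x.
split; first exact/asboolP.
by apply/eqP; exact: max_value_uniq (uP _ K0) maxt.
Qed.

(** Peeling off one coordinate at a time: the slices of the family along a
    coordinate hyperplane again satisfy the hypothesis, in one dimension less. *)
Lemma sum_nonempty_fixed_coords k K w : (forall i, compact_convex (K i)) ->
  (exists y : 'rV[R]_n, forall i x, K i x ->
     forall j : 'I_n, (k <= j)%N -> x 0 j = y 0 j) ->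
  (forall x, \sum_(i | `[< K i x >]) w i = 0) ->
  \sum_(i | `[< K i !=set0 >]) w i = 0.
Proof.
elim: k K => [|k IHk] K ccK [y Ky] sum0.
  rewrite -[RHS](sum0 y); apply: eq_bigl => i.
  apply: asbool_equiv_eq; split=> [[x Kx]|Kiy]; last by exists y.
  by rewrite (_ : y = x) //; apply/rowP => j; rewrite (Ky i x).
have [kn|nk] := ltnP k n; last first.
  apply: IHk ccK _ sum0; exists y => i x _ j kj.
  by have := ltn_ord j; rewrite ltnNge (leq_trans nk kj).
pose j0 := Ordinal kn; apply: (sum_nonempty_slices (c := delta_mx j0 0) ccK) => t.
apply: IHk.
- by move=> i; exact: compact_convex_slice.
- exists (\row_j if j == j0 then t else y 0 j) => i x [Kx].
  rewrite /hyperplane /= dot_delta => xt j kj; rewrite mxE.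
  case: eqVneq => [->//|jj0]; apply: Ky Kx _ _.
  by rewrite ltn_neqAle kj andbT eq_sym; apply: contraNneq jj0 => jk; apply/eqP/ord_inj.
move=> x; have [xt|xt] := pselect (hyperplane (delta_mx j0 0) t x).
  rewrite -[RHS](sum0 x); apply: eq_bigl => i.
  by apply: asbool_equiv_eq; split=> [[]|].
by rewrite big_pred0 // => i; apply: asboolF => -[].
Qed.

Lemma sum_nonempty K w : (forall i, compact_convex (K i)) ->
  (forall x, \sum_(i | `[< K i x >]) w i = 0) ->
  \sum_(i | `[< K i !=set0 >]) w i = 0.
Proof.
move=> ccK; apply: (@sum_nonempty_fixed_coords n) => //.
by exists 0 => i x _ j; rewrite leqNgt ltn_ord.
Qed.

Lemma sum_max_value_pointwise K w c t : (forall i, compact_convex (K i)) ->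
  (forall x, \sum_(i | `[< K i x >]) w i = 0) ->
  \sum_(i | `[< max_value (K i) c t >]) w i = 0.
Proof.
move=> ccK sum0; apply: sum_max_value => // s; apply: sum_nonempty => [i|x].
  exact: compact_convex_slice.
have [xs|xs] := pselect (hyperplane c s x).
  rewrite -[RHS](sum0 x); apply: eq_bigl => i.
  by apply: asbool_equiv_eq; split=> [[]|].
by rewrite big_pred0 // => i; apply: asboolF => -[].
Qed.

End Euler.

(** * Matroid polytopes and their faces *)

Section MatroidPolytope.
Variables (R : realType) (n : nat).
Local Notation Q := (@matroid_polytope R n).
Implicit Types (M N : matroid n) (c : 'cV[R]_n) (x : 'rV[R]_n).

Lemma dot_sum c (J : finType) (P : pred J) (F : J -> 'rV[R]_n) :
  dot c (\sum_(j | P j) F j) = \sum_(j | P j) dot c (F j).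
Proof. by rewrite /dot mulmx_suml summxE. Qed.

Lemma dot_suml (J : finType) (P : pred J) (F : J -> 'cV[R]_n) x :
  dot (\sum_(j | P j) F j) x = \sum_(j | P j) dot (F j) x.
Proof. by rewrite /dot mulmx_sumr summxE. Qed.

Lemma dot_indicator c (B : {set 'I_n}) :
  dot c (indicator R B) = weight (fun i => c i 0) B.
Proof.
rewrite /indicator dot_sum; apply: eq_bigr => i _.
by rewrite /dot -rowE mxE.
Qed.

Lemma matroid_polytopeP M x : Q M x <->
  exists a : {set 'I_n} -> R, [/\ forall B, 0 <= a B,
    \sum_(B in bases M) a B = 1
    & x = \sum_(B in bases M) a B *: indicator R B].
Proof.
split=> [[k [v [a [vM a0 a1 ->]]]]|[a [a0 a1 ->]]].
  have [b bP] := choice (fun i => let: ex_intro2 B p q := vM i in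
    ex_intro (fun B => B \in bases M /\ indicator R B = v i) B (conj p q)).
  exists (fun B => \sum_(i | b i == B) a i); split=> [B||].
  - by apply: sumr_ge0.
  - by rewrite -[RHS]a1 [RHS](partition_big b (mem (bases M))) // => i _; case: (bP i).
  rewrite (partition_big b (mem (bases M))) => [|i _]; last by case: (bP i).
  apply: eq_bigr => B _; rewrite scaler_suml; apply: eq_bigr => i /eqP <-.
  by case: (bP i) => _ ->.
exists #|bases M|, (fun i => indicator R (enum_val i)), (fun i => a (enum_val i)).
split=> // [i||].
- by exists (enum_val i) => //; exact: enum_valP.
- by rewrite -[RHS]a1 [RHS]big_enum_val.
by rewrite big_enum_val.
Qed.

Lemma indicator_matroid_polytope M (B : {set 'I_n}) :
  B \in bases M -> Q M (indicator R B).
Proof.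
move=> BM; apply/matroid_polytopeP; exists (fun B' => (B' == B)%:R); split.
- by move=> B'.
- by rewrite (bigD1 B) //= eqxx big1 ?addr0 // => B' /andP[_ /negPf->].
rewrite (bigD1 B) //= eqxx scale1r big1 ?addr0 // => B' /andP[_ /negPf->].
by rewrite scale0r.
Qed.

(** The polytope is a linear image of the part of a cube cut out by the equation
    that the coefficients of the bases sum to [1]. *)
Lemma compact_matroid_polytope M : compact (Q M).
Proof.
pose N := #|{set 'I_n}|.
pose f (v : 'rV[R]_N) :=
  \sum_(B in bases M) v 0 (enum_rank B) *: indicator R B.
pose total : 'cV[R]_N := \col_i (enum_val i \in bases M)%:R.
have totalE v : dot total v = \sum_(B in bases M) v 0 (enum_rank B).
  rewrite /dot mxE (reindex enum_rank (onW_bij _ (@enum_rank_bij _))) [RHS]big_mkcond /=.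
  apply: eq_bigr => B _; rewrite mxE enum_rankK.
  by case: (B \in bases M); rewrite ?mulr1 ?mulr0.
pose cube := [set v : 'rV[R]_N | forall i, `[0, 1]%classic (v ord0 i)].
have -> : Q M = f @` (cube `&` hyperplane total 1).
  apply/seteqP; split=> [x /matroid_polytopeP[a [a0 a1 ->]]|_ [v [v01 v1] <-]].
    pose v : 'rV[R]_N :=
      \row_i if enum_val i \in bases M then a (enum_val i) else 0.
    have vE B : B \in bases M -> v 0 (enum_rank B) = a B.
      by move=> BM; rewrite mxE enum_rankK BM.
    exists v; last by apply: eq_bigr => B /vE ->.
    split; last by rewrite /hyperplane /= totalE -[RHS]a1; apply: eq_bigr => B /vE.
    move=> i; rewrite /= in_itv /= mxE; case: ifPn => [iM|]; last by rewrite lexx ler01.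
    rewrite a0 -a1 (bigD1 (enum_val i)) //= lerDl.
    by apply: sumr_ge0.
  apply/matroid_polytopeP; exists (fun B => v 0 (enum_rank B)); split=> //.
    by move=> B; have := v01 (enum_rank B); rewrite /= in_itv => /andP[].
  by rewrite -totalE.
apply: continuous_compact; last first.
  apply: compact_closedI; last exact: closed_hyperplane.
  apply: (@rV_compact R N (fun=> `[0, 1]%classic)) => i.
  exact: segment_compact.
apply: continuous_subspaceT; apply: continuous_big => [|B _ v].
  exact: add_continuous.
apply: (@cvgZr_tmp _ _ _ (nbhs v)).
exact: coord_continuous.
Qed.

Lemma compact_convex_matroid_polytope M : compact_convex (Q M).
Proof.
split; first exact: compact_matroid_polytope.
move=> _ _ t /matroid_polytopeP[a [a0 a1 ->]] /matroid_polytopeP[b [b0 b1 ->]].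
move=> t0 t1; apply/matroid_polytopeP.
exists (fun B => t * a B + (1 - t) * b B); split.
- by move=> B; rewrite addr_ge0 ?mulr_ge0 ?subr_ge0.
- by rewrite big_split -!mulr_sumr a1 b1 /= !mulr1 addrC subrK.
rewrite !scaler_sumr -big_split; apply: eq_bigr => B _ /=.
by rewrite !scalerA scalerDl.
Qed.

(** On a face, a convex combination of bases only uses bases of the face, and
    these form a matroid. *)
Lemma matroid_polytope_face M c (b : R) :
  (forall x, Q M x -> dot c x <= b) ->
  exists2 N,
    bases N = [set B in bases M | weight (fun i => c i 0) B == b] &
    Q N = Q M `&` hyperplane c b.
Proof.
move=> cb.
have wb B : B \in bases M -> weight (fun i => c i 0) B <= b.
  by move=> BM; rewrite -dot_indicator; apply: cb; exact: indicator_matroid_polytope.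
pose N := Matroid (tight_bases_exchange wb).
have basesN : bases N = [set B in bases M | weight (fun i => c i 0) B == b] by [].
exists N => //; have memN B :
    (B \in bases N) = (B \in bases M) && (weight (fun i => c i 0) B == b).
  by rewrite basesN inE.
have sumN (V : zmodType) (F : {set 'I_n} -> V) :
    (forall B, B \in bases M -> weight (fun i => c i 0) B != b -> F B = 0) ->
    \sum_(B in bases M) F B = \sum_(B in bases N) F B.
  move=> F0; rewrite (bigID (fun B => weight (fun i => c i 0) B == b)) /=.
  rewrite [X in _ + X]big1 ?addr0 => [|B /andP[]]; last exact: F0.
  by apply: eq_bigl => B; rewrite memN.
apply/seteqP; split=> [x /matroid_polytopeP[a [a0 a1 ->]]|x []].
  split.
    apply/matroid_polytopeP; exists (fun B => if B \in bases N then a B else 0).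
    split=> [B||].
    - by case: ifP.
    - by rewrite sumN => [|B BM Bb]; rewrite ?memN ?(negPf Bb) ?andbF //
        -[RHS]a1; apply: eq_bigr => B ->.
    rewrite [RHS]sumN => [|B BM Bb]; last by rewrite memN (negPf Bb) andbF scale0r.
    by apply: eq_bigr => B ->.
  rewrite /hyperplane /= dot_sum -[RHS]mul1r -a1 mulr_suml.
  apply: eq_bigr => B; rewrite memN => /andP[_ /eqP Bb].
  by rewrite dotZ dot_indicator Bb.
move=> /matroid_polytopeP[a [a0 a1 ->]].
rewrite /hyperplane /= dot_sum => xb.
(* The nonnegative slacks have average zero, so each with positive coefficient
   vanishes. *)
have slack0 : \sum_(B in bases M) a B * (b - weight (fun i => c i 0) B) = 0.
  under eq_bigr do rewrite mulrBr.
  rewrite sumrB -mulr_suml a1 mul1r -[X in X - _]xb -sumrB big1 // => B _.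
  by rewrite dotZ dot_indicator subrr.
have a_tight B : B \in bases M -> weight (fun i => c i 0) B != b -> a B = 0.
  have slack_ge0 B' : B' \in bases M ->
      0 <= a B' * (b - weight (fun i => c i 0) B').
    by move=> B'M; rewrite mulr_ge0 ?subr_ge0 ?wb.
  move=> BM Bb; have := psumr_eq0P slack_ge0 slack0 BM.
  by move/eqP; rewrite mulf_eq0 subr_eq0 [b == _]eq_sym (negPf Bb) orbF => /eqP.
apply/matroid_polytopeP; exists a; split=> //; first by rewrite -sumN.
by apply: sumN => B BM Bb; rewrite a_tight ?scale0r.
Qed.

(** If the maximum over the polytope is the weight of [B], the face where it is
    attained is the polytope of some matroid with a basis; that basis has the
    weight of [B], hence is [B]. *)
Lemma max_value_matroid_polytope M (a : 'I_n -> int) (B : {set 'I_n}) :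
  injective (weight a) ->
  max_value (Q M) (\col_i (a i)%:~R) (weight a B)%:~R <->
  max_basis M a B.
Proof.
move=> a_inj; set c := \col_i _.
have wE B' : weight (fun i => c i 0) B' = (weight a B')%:~R :> R.
  by rewrite /weight rmorph_sum; apply: eq_bigr => i _; rewrite mxE.
split=> [[[x xM xB] maxB]|/andP[BM /forall_inP maxB]].
  have [N NE QN] := matroid_polytope_face maxB.
  have : Q N x by rewrite QN.
  move=> /matroid_polytopeP[d [_ d1 _]].
  have [N0|[B' ]] := set_0Vmem (bases N).
    by move/eqP: d1; rewrite N0 big_set0 eq_sym oner_eq0.
  rewrite NE inE wE eqr_int => /andP[BM /eqP/a_inj B'B].
  rewrite {}B'B in BM; rewrite /max_basis BM; apply/forall_inP => B'' B''M.
  have := maxB _ (indicator_matroid_polytope B''M).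
  by rewrite dot_indicator wE ler_int.
have indB := indicator_matroid_polytope BM; split.
  by exists (indicator R B); rewrite // dot_indicator wE.
move=> _ /matroid_polytopeP[d [d0 d1 ->]].
rewrite dot_sum -[leRHS]mul1r -[X in _ <= X * _]d1 mulr_suml; apply: ler_sum => B' B'M.
rewrite dotZ dot_indicator wE; apply: ler_wpM2l => //.
by rewrite ler_int maxB.
Qed.

End MatroidPolytope.

(** * Matroid subdivisions *)

Section Subdivision.
Variables (R : realType) (n m : nat) (M : matroid n) (Ms : 'I_m -> matroid n).
Hypothesis MsP : is_matroid_subdivision R M Ms.
Local Notation Q := (@matroid_polytope R n).

(** The functionals [0 <= 0] and [0 <= 1] cut out the improper face, when
    [a = b], and the empty face, when the pieces are disjoint. *)
Lemma subdivision_face (a b : 'I_m) : is_face (Q (Ms a) `&` Q (Ms b)) (Q (Ms a)).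
Proof.
have [->|ab] := eqVneq a b.
  exists 0, 0; split=> [x _|]; rewrite ?mulmx0 ?mxE //.
  by apply/seteqP; split=> x; rewrite /= mulmx0 mxE => -[].
have [ne|empty] := pselect (Q (Ms a) `&` Q (Ms b) !=set0).
  move: ab; rewrite neq_ltn => /orP[ab|ba].
    by have [[]] := subdiv_faces MsP ab ne.
  rewrite classical_sets.setIC in ne *.
  by have [_ []] := subdiv_faces MsP ba ne.
exists 0, 1; split=> [x _|]; first by rewrite mulmx0 mxE ler01.
apply/seteqP; split=> x /=; first by move=> Qab; case: empty; exists x.
by rewrite mulmx0 mxE => -[_ /esym/eqP]; rewrite oner_eq0.
Qed.

(** Fixing [a0] in [A], each piece indexed by [A] meets that of [a0] in a face; the
    sum of the inequalities defining these faces defines their intersection. *)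
Lemma subdivision_meet_polytope (A : {set 'I_m}) : A != finset.set0 ->
  Q (subdivision_meet R M Ms A) = \bigcap_(a in [set` A]) Q (Ms a).
Proof.
move=> A0; rewrite /subdivision_meet (negPf A0).
apply: (@xgetPex _ _ [set N | Q N = _]).
have /set0Pn[a0 a0A] := A0.
have [c cP] := choice (subdivision_face a0); have [b bP] := choice cP.
have [|N _ QN] := @matroid_polytope_face R n (Ms a0)
  (\sum_(a in A) c a) (\sum_(a in A) b a).
  move=> x Qx; rewrite dot_suml; apply: ler_sum => a _.
  exact: (bP a).1.
exists N; rewrite /= QN; apply/seteqP; split=> x.
  move=> [Qx]; rewrite /hyperplane /= dot_suml => /eqP.
  rewrite eq_sym -subr_eq0 -sumrB => /eqP sum0 a aA.
  have slack_ge0 a' : a' \in A -> 0 <= b a' - dot (c a') x.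
    by move=> _; rewrite subr_ge0; exact: (bP a').1.
  have /eqP := psumr_eq0P slack_ge0 sum0 aA; rewrite subr_eq0 => /eqP ba.
  have : (Q (Ms a0) `&` Q (Ms a)) x by rewrite (bP a).2.
  by case.
move=> Qx; split; first exact: Qx.
rewrite /hyperplane /= dot_suml; apply: eq_bigr => a aA.
have : (Q (Ms a0) `&` Q (Ms a)) x by split; exact: Qx.
by rewrite (bP a).2 => -[].
Qed.

(** At a point [x] of [M], the sum runs over all subsets of the nonempty set of
    pieces containing [x]. *)
Lemma sum_subdivision_meet x :
  \sum_(A | `[< Q (subdivision_meet R M Ms A) x >]) (-1) ^+ #|A| = 0 :> int.
Proof.
have [Qx|nQx] := pselect (Q M x); last first.
  rewrite big_pred0 // => A; apply: asboolF.
  have [->|A0] := eqVneq A finset.set0; first by rewrite /subdivision_meet eqxx.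
  rewrite subdivision_meet_polytope //; have /set0Pn[a aA] := A0.
  by move=> /(_ a aA) Qx; apply: nQx; rewrite -(subdiv_cover MsP); exists a.
pose J := finset.finset (fun a : 'I_m => `[< Q (Ms a) x >]).
rewrite -(@alternating_sum_subsets _ J).
  apply: eq_bigl => A; have [->|A0] := eqVneq A finset.set0.
    by rewrite finset.sub0set /subdivision_meet eqxx asboolT.
  rewrite subdivision_meet_polytope //; apply/asboolP/fintype.subsetP => [Qa a aA|AJ a aA].
    by rewrite inE; apply/asboolP/Qa.
  by have := AJ _ aA; rewrite inE => /asboolP.
move: Qx; rewrite -(subdiv_cover MsP) => -[a _ Qa].
by apply/set0Pn; exists a; rewrite inE; apply/asboolP.
Qed.

End Subdivision.

Theorem theorem5p4 (R : realType) (n : nat) (n_gt0 : (0 < n)%N) :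
  is_valuation R (@activity_sum n).
Proof.
split=> [|m M Ms MsP]; first by apply: big_pred0 => B; rewrite inE.
apply: activity_sum_combination_eq0 => B X.
have a_inj := @weight_activity_inj _ B X.
rewrite -[RHS](sum_max_value_pointwise (\col_i (activity_weight B X i)%:~R)
  (weight (activity_weight B X) B)%:~R
  (fun A => compact_convex_matroid_polytope R (subdivision_meet R M Ms A))
  (sum_subdivision_meet MsP)).
apply: eq_bigl => A; rewrite -max_basis_active.
by apply/idP/asboolP => /(max_value_matroid_polytope R _ _ a_inj).
Qed.
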